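(* Let $F$ be a field with $\operatorname{char}(F)\neq 2$. Then $F\in\Lambda$ if and only if $F\in\Gamma$.
   Context: For a field $F$, an $F$-algebra is a vector space $A$ over $F$ with a bilinear multiplication $A\times A\to A$, $(x,y)\mapsto xy$; associativity, commutativity and existence of a unit are not assumed. Finite-dimensional means $1\le \dim_F A<\infty$. An idempotent of $A$ is $x\in A$, $x\neq 0$, with $x^2=x$. An absolute nilpotent of $A$ is $x\in A$, $x\neq 0$, with $x^2=0$. $\Lambda$ is the class of fields $F$ such that every finite-dimensional $F$-algebra contains either an idempotent or an absolute nilpotent. Equivalently, $F\in\Lambda$ means that for every finite-dimensional vector space $A\ne 0$ over $F$, every quadratic operator $V$ on $A$ (a map of the form $Vx=x^2$ for some $F$-algebra structure on $A$) has an eigenvector, i.e. there are $x\in A$, $x\neq 0$, and $\lambda\in F$ with $Vx=\lambda x$. $\Gamma$ is the class of fields $F$ such that every polynomial of odd degree with coefficients in $F$ has a root in $F$. *)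

(* Defs.v *)
From HB Require Import structures.
From mathcomp Require Import all_boot all_algebra.

Set Implicit Arguments.
Unset Strict Implicit.
Unset Printing Implicit Defensive.

Import GRing.Theory.
Local Open Scope ring_scope.

(* A finite-dimensional F-algebra is a pair (A, mul), where A is a nonzero
   space in vectType F (finite-dimensional vector spaces) and mul is an
   arbitrary bilinear map; MathComp's own algebra structures are not used
   because they all assume associativity and a unit. *)

Definition idempotent_of (F : fieldType) (A : vectType F)
    (mul : {bilinear A -> A -> A}) (x : A) : Prop :=
  x <> 0 /\ mul x x = x.

Definition absolute_nilpotent_of (F : fieldType) (A : vectType F)
    (mul : {bilinear A -> A -> A}) (x : A) : Prop :=
  x <> 0 /\ mul x x = 0.

Definition Lambda (F : fieldType) : Prop :=
  forall (A : vectType F) (mul : {bilinear A -> A -> A}),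
    (0 < \dim {:A})%N ->
    (exists x : A, idempotent_of mul x) \/
    (exists x : A, absolute_nilpotent_of mul x).

(* [(size p).-1] is the degree of [p] for p != 0; it is 0, hence even, for the
   zero polynomial, which is therefore excluded. *)
Definition Gamma (F : fieldType) : Prop :=
  forall p : {poly F}, odd (size p).-1 -> exists x : F, root p x.

(* Main.v *)
(** Lambda implies Gamma.  Let [L] be a finite extension of [F] with an
    [F]-automorphism [s], let [c <> 0] in [L], and consider on [L^m] the
    quadratic map sending [(x_0, ..., x_(m-1))] to
    [(c x_(m-1) s^(2^(m-1))(x_(m-1)), x_0 s(x_0), x_1 s^2(x_1), ...)].  It is
    anisotropic and its idempotents satisfy [c * prod_(i < 2^m) s^i(x) = x]
    with [x = x_0 <> 0].  If [s] has odd order [l] and [l] divides [2^m - 1],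
    this makes [c] invariant under [s]; as [c] is arbitrary, [s] is trivial.
    With [s] the identity it shows instead that [F] is closed under odd roots.
    Hence an irreducible polynomial of odd degree is separable, and the order
    of its Galois group, which has no odd prime factor by Cauchy's theorem but
    is divisible by the degree, forces the degree to be 1.

    Gamma implies Lambda.  The nonzero solutions of the deformed system
    [z_i^2 + s V_i(z) = z_i] number [N = 2^n - 1], which is odd: at [s = 0]
    they are the nonzero vertices of the cube.  The coordinates act on the
    algebra of these solutions by commuting [N x N] matrices [A_i] over
    [F[s]], written in the basis of squarefree monomials.  Letting [s] go to
    infinity, on a lattice over the valuation ring at infinity, yields
    commuting matrices [Y_i] over [F], not all nilpotent, on which
    [Y_i V_j(Y) = Y_j V_i(Y)].  As [N] is odd, [Gamma F] provides a common
    eigenvector, and the eigenvalues are the coordinates of an eigenvector of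
    [V]. *)
Require Import Defs.
From HB Require Import structures.
From Stdlib Require Import Classical.
From mathcomp Require Import all_boot all_fingroup all_algebra all_solvable all_field.
From mathcomp Require Import zify ring.

Set Implicit Arguments.
Unset Strict Implicit.
Unset Printing Implicit Defensive.

Import GRing.Theory.
Local Open Scope ring_scope.

(** * Automorphisms of odd order and odd roots *)

(** The second half of the product is the first one moved by an iterate of [s]; the coordinates of
    an idempotent in [Lambda_eigen] obey this recursion. *)
Lemma prod_iter_double (R : comNzRingType) (s : {rmorphism R -> R}) (x : R) k :
  \prod_(i < 2 ^ k.+1) iter i s x =
  (\prod_(i < 2 ^ k) iter i s x) * iter (2 ^ k) s (\prod_(i < 2 ^ k) iter i s x).
Proof.
have it_prod l : iter l s (\prod_(i < 2 ^ k) iter i s x) =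
    \prod_(i < 2 ^ k) iter (l + i) s x.
  elim: l => [|l /= ->]; first by apply: eq_bigr.
  by rewrite rmorph_prod.
by rewrite it_prod expnS mul2n -addnn big_split_ord.
Qed.

(** The [m.+1] coordinates form a cycle: coordinate [j] of a square is built from coordinate
    [ord_pred j], with the factor [c] where the cycle closes. Following an idempotent around once
    gives the equation. *)
Lemma Lambda_eigen (F : fieldType) (L : fieldExtType F) (s : {lrmorphism L -> L})
    (c : L) (m : nat) :
  Lambda F -> c != 0 ->
  exists2 x : L, x != 0 & c * \prod_(i < 2 ^ m.+1) iter i s x = x.
Proof.
move=> LF c0; pose A := {ffun 'I_m.+1 -> L}.
pose mulA (u v : A) : A := [ffun j => (if j == ord0 then c else 1) *
  (u (ord_pred j) * iter (2 ^ ord_pred j) s (v (ord_pred j)))].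
have itL k (a : F) x y : iter k s (a *: x + y) = a *: iter k s x + iter k s y.
  by elim: k => //= k ->; rewrite linearP.
have it0 k x : iter k s x = 0 -> x = 0.
  by elim: k => //= k IH /eqP; rewrite fmorph_eq0 => /eqP.
have mul_bil : bilinear_for *:%R *:%R mulA.
  split=> [w a u v | w a u v]; apply/ffunP=> j; rewrite !ffunE.
    by rewrite mulrDl mulrDr -!scalerAl -scalerAr.
  by rewrite itL mulrDr mulrDr -!scalerAr.
pose B : {bilinear A -> A -> A} := HB.pack mulA (bilinear_isBilinear.Build _ _ _ _ _ _ mulA mul_bil).
have mulE (u : A) j : B u u j = (if j == ord0 then c else 1) *
  (u (ord_pred j) * iter (2 ^ ord_pred j) s (u (ord_pred j))) by rewrite ffunE.
case: (LF A B).
- rewrite lt0n dimv_eq0; apply/eqP=> A0.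
  have := memvf ([ffun=> 1] : A); rewrite A0 memv0 => /eqP/ffunP/(_ ord0).
  by rewrite !ffunE => /eqP; rewrite oner_eq0.
- case=> u [u0 uu].
  have chain k : forall lt_k : (k < m.+1)%N,
      u (Ordinal lt_k) = \prod_(i < 2 ^ k) iter i s (u ord0).
    elim: k => [|k IH] lt_k.
      by rewrite big_ord1 /=; congr (u _); apply: val_inj.
    have lt_k' : (k < m.+1)%N by rewrite ltnW.
    have pk : ord_pred (Ordinal lt_k) = Ordinal lt_k'.
      by apply: val_inj; rewrite /= modnDr modn_small.
    by rewrite -{1}uu mulE pk /= mul1r IH prod_iter_double.
  have pk : ord_pred (ord0 : 'I_m.+1) = ord_max.
    by apply: val_inj; rewrite /= modn_small.
  exists (u ord0).
    apply/eqP=> u00; apply: u0; apply/ffunP=> -[k lt_k].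
    have two_gt0 : (0 < 2 ^ k)%N by rewrite expn_gt0.
    by rewrite chain ffunE (bigD1 (Ordinal two_gt0)) //= u00 mul0r.
  rewrite -[RHS]/((u : A) ord0) -[in RHS]uu mulE pk /= prod_iter_double.
  by rewrite -(chain m (ltnSn m)); congr (_ * (u _ * iter _ _ (u _))); apply: val_inj.
(* Coordinate [ordS j] of the square is, up to a nonzero factor, [u j] times its image under an
   iterate of the injective [s], so it vanishes only if [u j] does. *)
- case=> u [u0 uu]; case: u0; apply/ffunP=> j; rewrite ffunE.
  have /eqP := mulE u (ordS j); rewrite uu ffunE ordSK eq_sym mulf_eq0 => /orP[].
    by case: ifP; rewrite ?oner_eq0 // (negPf c0).
  by rewrite mulf_eq0 => /orP[]/eqP // /it0.
Qed.

(** Euler's theorem, with [m.+1] the totient of [p]. *)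
Lemma dvdn_pow2_pred p : odd p -> exists m, (p %| (2 ^ m.+1).-1)%N.
Proof.
move=> odd_p; have p_gt0 : (0 < p)%N by case: p odd_p.
exists (totient p).-1; rewrite prednK ?totient_gt0 // -subn1.
by rewrite -eqn_mod_dvd ?expn_gt0 // Euler_exp_totient // coprime2n.
Qed.

Lemma Lambda_pth_power (F : fieldType) p (c : F) :
  Lambda F -> odd p -> exists x, x ^+ p = c.
Proof.
move=> LF odd_p; have [-> | c0] := eqVneq c 0.
  by exists 0; rewrite expr0n; case: p odd_p.
have [m /dvdnP[q Dq]] := dvdn_pow2_pred odd_p.
have [x x0] := @Lambda_eigen F F^o idfun (c : F^o) m LF c0.
rewrite (eq_bigr (fun=> x)) => [|i _]; last by elim: (i : nat) => //= k ->.
rewrite prodr_const card_ord -(prednK (_ : 0 < 2 ^ m.+1)%N) ?expn_gt0 //.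
rewrite Dq exprS mulrCA => Dx; exists (x ^- q).
have xqp0 : x ^+ (q * p) != 0 by rewrite expf_neq0.
apply: (mulIf xqp0); rewrite exprVn -exprM mulVf //.
by apply: (mulfI x0); rewrite mulr1 [RHS]Dx.
Qed.

(** Cancelling [x] in [Lambda_eigen] makes [c] the inverse of the product of the [s^i(x)] for
    [1 <= i <= q * n], whose factors [s] permutes cyclically. *)
Lemma Lambda_odd_order (F : fieldType) (L : fieldExtType F) (s : {lrmorphism L -> L}) n :
  Lambda F -> odd n -> (forall x, iter n s x = x) -> forall c, s c = c.
Proof.
move=> LF odd_n sn c; have [-> | c0] := eqVneq c 0; first by rewrite rmorph0.
have [m /dvdnP[q Dq]] := dvdn_pow2_pred odd_n.
have [x x0] := @Lambda_eigen F L s c m LF c0.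
rewrite -(prednK (_ : 0 < 2 ^ m.+1)%N) ?expn_gt0 // Dq big_ord_recl /=.
set P := \prod_(_ < _) _ => Dx.
have cP1 : c * P = 1 by apply: (mulfI x0); rewrite mulr1 mulrCA.
have sP : s P = P.
  have iter_qn : iter (q * n) s (s x) = s x.
    by elim: (q) => // k IH; rewrite mulSn iterD IH sn.
  rewrite rmorph_prod /P; case: (q * n)%N iter_qn => [|k] sk; first by rewrite !big_ord0.
  rewrite big_ord_recr [RHS]big_ord_recl mulrC; congr (_ * _).
  by rewrite -[RHS]/(s x) -[in RHS]sk /= -!iterSr.
have P0 : P != 0 by apply: contraTneq isT => P0; move/eqP: cP1; rewrite P0 mulr0 eq_sym oner_eq0.
by apply: (mulIf P0); rewrite -{1}sP -rmorphM cP1 rmorph1.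
Qed.

(** * Splitting fields *)

(** Degrees add up over a factorization, so [P] holds for one of the factors. It is used with [P]
    positivity and with [P] oddness. *)
Lemma irreducible_factor (F : fieldType) (P : pred nat) (p : {poly F}) :
  ~~ P 0%N -> (forall m n, P (m + n)%N -> P m || P n) -> P (size p).-1 ->
  exists r, [/\ r %| p, irreducible_poly r & P (size r).-1].
Proof.
move=> nP0 PD; elim: {p}(size p) {-2}p (leqnn (size p)) => [|n IH] p le_pn Pp.
  by move: Pp; rewrite leqn0 in le_pn; rewrite (eqP le_pn) (negPf nP0).
have p_gt1 : (1 < size p)%N by case: (size p) Pp => [|[]] //; rewrite (negPf nP0).
have p0 : p != 0 by rewrite -size_poly_gt0 ltnW.
have [[q [q1 q_p q'p]] | irr] :=
    classic (exists q : {poly F}, [/\ size q != 1, q %| p & ~~ (q %= p)]); last first.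
  exists p; split=> //; split=> // q q1 q_p; apply/negPn/negP=> q'p.
  by apply: irr; exists q.
have /dvdpP[u Dp] := q_p.
have /norP[u0 q0] : ~~ ((u == 0) || (q == 0)) by rewrite -mulf_eq0 -Dp.
have lt_qp : (size q < size p)%N.
  by rewrite ltn_neqAle dvdp_leq // andbT dvdp_size_eqp.
have Dsz : (size p = (size u + size q).-1)%N by rewrite Dp size_mul.
have u_gt0 : (0 < size u)%N by rewrite size_poly_gt0.
have q_gt0 : (0 < size q)%N by rewrite size_poly_gt0.
have lt_up : (size u < size p)%N by lia.
have {}Pp : P ((size u).-1 + (size q).-1)%N by move: Pp; congr P; lia.
have [v [v_p]] : exists v, [/\ v %| p, (size v < size p)%N & P (size v).-1].
  by case/orP: (PD _ _ Pp) => ?; [exists u | exists q]; split=> //; rewrite Dp dvdp_mulr.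
move=> lt_vp Pv; have [r [r_v irr_r Pr]] := IH v (leq_trans lt_vp le_pn) Pv.
by exists r; split=> //; apply: dvdp_trans v_p.
Qed.

Lemma exists_split_ext (F : fieldType) (p : {poly F}) : p != 0 ->
  exists (L : fieldExtType F) (zs : seq L),
    map_poly (in_alg L) p %= \prod_(z <- zs) ('X - z%:P).
Proof.
have [n] := ubnP (size p); elim: n F p => [|n IH] F p // le_pn p0.
have [p_le1 | p_gt1] := leqP (size p) 1.
  exists F^o, [::]; rewrite big_nil -size_poly_eq1 size_map_poly.
  by rewrite eqn_leq p_le1 size_poly_gt0.
have [|||r [r_p irr_r _]] := @irreducible_factor F (leq 1) p => //.
- by move=> [].
- by rewrite -ltnS prednK // ltnW.
have [K _ [x rx0 _]] := irredp_FAdjoin irr_r.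
have /factor_theorem[q Dp] : root (map_poly (in_alg K) p) x.
  by rewrite -(divpK r_p) rmorphM rootM rx0 orbT.
have q0 : q != 0.
  apply: contraNneq p0 => q0; move/eqP: Dp.
  by rewrite q0 mul0r map_poly_eq0.
have Dsz : size p = (size q).+1.
  by rewrite -(size_map_poly (in_alg K)) Dp size_Mmonic ?monicXsubC // size_XsubC addn2.
have [||L [zs Dq]] := IH K q => //; first by rewrite Dsz in le_pn.
(* [L] is built over [K]; [baseFieldType L] is [L] seen as an extension of [F]. *)
exists (baseFieldType L), (in_alg L x :: zs).
have -> : map_poly (in_alg (baseFieldType L)) p = map_poly (in_alg L) (map_poly (in_alg K) p).
  by rewrite -map_poly_comp; apply: eq_map_poly => a; rewrite /= baseField_scaleE.
rewrite Dp rmorphM /= rmorphB /= map_polyX map_polyC big_cons mulrC.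
exact: (eqp_mull _ Dq).
Qed.

(** The subfield generated by the roots becomes a type of its own, and the factorization is pulled
    back along its inclusion [f]. *)
Lemma exists_splitting_field (F : fieldType) (p : {poly F}) : p != 0 ->
  exists L : splittingFieldType F, splittingFieldFor 1 (map_poly (in_alg L) p) {:L}.
Proof.
move=> p0; have [L [zs Dp]] := exists_split_ext p0.
pose E : {subfield L} := <<1 & zs>>%AS; pose K := subvs_of E.
pose f : 'AHom(K, L) := linfun_ahom (vsval : {lrmorphism K -> L}).
have fE (x : K) : f x = vsval x by rewrite lfunE.
have Ezs : map f (map (vsproj E) zs) = zs.
  rewrite -map_comp map_id_in // => z z_zs.
  by rewrite /= fE vsprojK // seqv_sub_adjoin.
have splitK : splittingFieldFor 1 (map_poly (in_alg K) p) {:K}.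
  exists (map (vsproj E) zs).
    rewrite -(eqp_map f) -map_poly_comp rmorph_prod.
    rewrite (eq_map_poly (fun a => rmorph_alg f a)).
    apply: eqp_trans Dp _; rewrite -[X in \prod_(z <- X) _]Ezs !big_map.
    rewrite (eq_bigr (fun z => map_poly f ('X - (vsproj E z)%:P))) ?eqpxx // => z _.
    by rewrite rmorphB /= map_polyX map_polyC.
  apply/vspaceP=> x; rewrite memvf.
  have : vsval x \in (f @: <<1 & map (vsproj E) zs>>)%VS.
    by rewrite aimg_adjoin_seq aimg1 Ezs (valP x).
  by case/memv_imgP=> y Ly; rewrite fE => /val_inj->.
have axK : splitting_field_axiom K by exists (map_poly (in_alg K) p); first exact: alg_polyOver.
pose S : splittingFieldType F := HB.pack K (FieldExt_isSplittingField.Build F K axK).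
by exists S.
Qed.

(** If [q] is inseparable, its derivative vanishes, so the characteristic [p] divides every exponent
    of [q], in particular its odd degree. The coefficients then have [p]-th roots, and Frobenius
    makes [q] a [p]-th power. *)
Lemma Lambda_irreducible_odd_separable (F : fieldType) (q : {poly F}) :
  Lambda F -> irreducible_poly q -> odd (size q).-1 -> separable_poly q.
Proof.
move=> LF irr_q odd_q; have q0 := irredp_neq0 irr_q.
apply/negPn/negP=> insep_q.
have dq0 : q^`() = 0.
  apply/eqP; apply: contraR insep_q => dq0; rewrite separable_poly.unlock coprimep_def.
  apply: contraT => /irr_q.2/(_ (dvdp_gcdl _ _)) Dq.
  have := dvdp_leq dq0 (dvdp_gcdr q q^`()).
  by rewrite (eqp_size Dq) leqNgt lt_size_deriv.
have Dq i : q`_i *+ i = 0.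
  by case: i => [|i]; rewrite ?mulr0n // -coef_deriv dq0 coef0.
have deg_gt0 : (0 < (size q).-1)%N by case: (size q).-1 odd_q.
have [p pcharF] : exists p, p \in [pchar F].
  apply: (natf0_pchar deg_gt0); move/eqP: (Dq (size q).-1).
  by rewrite -[X in X == _]mulr_natr mulf_eq0 -/(lead_coef q) lead_coef_eq0 (negPf q0).
have p_dvd i : q`_i != 0 -> (p %| i)%N.
  move=> qi; move/eqP: (Dq i).
  by rewrite -[X in X == _]mulr_natr mulf_eq0 (negPf qi) -(dvdn_pcharf pcharF).
have odd_p : odd p by apply: dvdn_odd odd_q; apply: p_dvd; rewrite -/(lead_coef q) lead_coef_eq0.
have p_gt1 : (1 < p)%N by apply: prime_gt1; apply: pcharf_prime pcharF.
have [b Db] := fin_all_exists (fun i : 'I_(size q) => Lambda_pth_power q`_(i * p) LF odd_p).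
pose h := \sum_(i < size q) b i *: 'X^i.
have pcharP : p \in [pchar {poly F}] by rewrite pchar_poly.
have Dqh : q = h ^+ p.
  rewrite -(pFrobenius_autE pcharP) rmorph_sum; apply/polyP=> k; rewrite coef_sum.
  rewrite (eq_bigr (fun i : 'I_(size q) => q`_(i * p) * (k == (i * p)%N)%:R)); last first.
    by move=> i _; rewrite /= pFrobenius_autE exprZn -exprM coefZ coefXn Db.
  have [/dvdnP[j ->] | p'k] := boolP (p %| k)%N; last first.
    rewrite big1 => [|i _]; first by apply/eqP; apply: contraR p'k => /p_dvd.
    by case: eqP p'k => [->|]; rewrite ?dvdn_mull // mulr0.
  have [lt_j | le_j] := ltnP j (size q).
    rewrite (bigD1 (Ordinal lt_j)) //= eqxx mulr1 big1 ?addr0 // => i ne_ij.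
    by rewrite eqn_pmul2r ?(ltnW p_gt1) // -[j == i]/(Ordinal lt_j == i :> 'I_ _) eq_sym (negPf ne_ij) mulr0.
  rewrite nth_default ?big1 // => [i _|].
    by rewrite eqn_pmul2r ?(ltnW p_gt1) // gtn_eqF ?mulr0 // (leq_trans (ltn_ord i)).
  by rewrite (leq_trans le_j) // leq_pmulr // ltnW.
have sz : ((size q).-1 = (size h).-1 * p)%N by rewrite Dqh size_exp.
have h_gt1 : (1 < size h)%N.
  by move: deg_gt0; rewrite sz; case: (size h) => [|[]].
have /eqp_size Dh : h %= q.
  by apply: irr_q.2; [rewrite gtn_eqF | rewrite Dqh -(prednK (ltnW p_gt1)) exprS dvdp_mulr].
move: sz; rewrite -Dh => /eqP; rewrite -{1}[(size h).-1]muln1 eqn_pmul2l; first by rewrite ltn_eqF.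
by rewrite -ltnS prednK // ltnW.
Qed.

(** If the degree of [q] exceeds 1, an odd prime [l] divides it, hence divides the order of the
    Galois group. Cauchy's theorem gives an element of order [l], which [Lambda_odd_order] forces to
    be trivial. *)
Lemma Lambda_irreducible_odd_linear (F : fieldType) (q : {poly F}) :
  Lambda F -> irreducible_poly q -> odd (size q).-1 -> size q = 2%N.
Proof.
move=> LF irr_q odd_q; have sep_q := Lambda_irreducible_odd_separable LF irr_q odd_q.
have q0 : q != 0 by apply: irredp_neq0.
have [L splitL] := exists_splitting_field q0.
have galL : galois 1 {:L}.
  apply/splitting_galoisField; exists (map_poly (in_alg L) q); split=> //.
    exact: alg_polyOver.
  by rewrite separable_map.
have [-> // | sz_q] := eqVneq (size q) 2%N.
have [z qz0] : exists z, root (map_poly (in_alg L) q) z.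
  have [[|z zs] Dq _] := splitL; last by exists z; rewrite (eqp_root Dq) big_cons rootM root_XsubC eqxx.
  by rewrite big_nil -size_poly_eq1 size_map_poly in Dq; rewrite (eqP Dq) in odd_q.
have dimz : \dim <<1; z>> = (size q).-1.
  have /polyOver1P[m Dm] := minPolyOver 1 z.
  have m_q : m %| q by rewrite -(dvdp_map (in_alg L)) -Dm minPoly_dvdp // alg_polyOver.
  have sz_m : size m = (\dim <<1; z>>).+1.
    by rewrite -(size_map_poly (in_alg L)) -Dm size_minPoly adjoin_degreeE dimv1 divn1.
  by rewrite -(eqp_size (irr_q.2 m _ m_q)) ?sz_m // eqSS -lt0n adim_gt0.
have dvd_dim : ((size q).-1 %| #|('Gal({:L} / 1))%g|)%N.
  rewrite -galois_dim // dimv1 divn1 -dimz.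
  exact/field_dimS/subvf.
have q_gt2 : (1 < (size q).-1)%N by case: irr_q => + _; lia.
have pr_l := pdiv_prime q_gt2; set l := pdiv _ in pr_l.
have odd_l : odd l by apply: dvdn_odd odd_q; apply: pdiv_dvd.
have [x Gx ox] := Cauchy pr_l (dvdn_trans (pdiv_dvd _) dvd_dim).
have iter_x k y : iter k x y = (x ^+ k)%g y.
  by elim: k => [|k /= ->]; rewrite ?gal_id // expgSr galM ?memvf.
have x1 : x = 1%g.
  apply/eqP/gal_eqP => y _; rewrite gal_id.
  apply: (Lambda_odd_order (s := gal_repr x) LF odd_l) => z'.
  by rewrite iter_x -ox expg_order gal_id.
by move: pr_l; rewrite -ox x1 order1.
Qed.

Lemma Lambda_Gamma (F : fieldType) : Lambda F -> Gamma F.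
Proof.
move=> LF p odd_p.
have [|m n|r [r_p irr_r odd_r]] := @irreducible_factor F odd p _ _ odd_p => //.
  by rewrite oddD; case: odd; case: odd.
have sz_r := Lambda_irreducible_odd_linear LF irr_r odd_r.
have [x rx] := @poly2_root _ r sz_r.
by exists x; exact: root_dvdp r_p rx.
Qed.

(** * Commuting matrices of odd size *)

(* Take a root of ['X * p ^+ 2 + 1]. *)
Lemma Gamma_nonroot (F : fieldType) (p : {poly F}) :
  Gamma F -> p != 0 -> exists x, p.[x] != 0.
Proof.
move=> GF p0; have [|x] := GF ('X * p ^+ 2 + 1%:P).
  rewrite size_polyDl ?size_polyC ?oner_eq0 size_mul ?polyX_eq0 ?expf_neq0 // size_polyX /=.
    by rewrite -[(size _)]prednK ?size_poly_gt0 ?expf_neq0 // size_exp /= muln2 odd_double.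
  by rewrite ltnS size_poly_gt0 expf_neq0.
rewrite /root hornerD hornerM hornerX horner_exp hornerC => Dx; exists x.
by apply: contraTneq Dx => ->; rewrite expr0n mulr0 add0r oner_eq0.
Qed.

Lemma Gamma_odd_eigenvalue (F : fieldType) N (M : 'M[F]_N) :
  Gamma F -> odd N -> exists x, eigenvalue M x.
Proof.
move=> GF odd_N; have [|x] := GF (char_poly M); first by rewrite size_char_poly.
by rewrite -eigenvalue_root_char; exists x.
Qed.

(** Induction on a stable space [U] of odd rank. If some [Y i] is not scalar on [U], it has an
    eigenvalue [x] there. The kernel and image of [Y i - x] on [U] are stable by commutation and
    nonzero, and their ranks have an odd sum, so one of them is a smaller space of odd rank. *)
Lemma Gamma_common_eigenvector (F : fieldType) N (I : Type) (Y : I -> 'M[F]_N) :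
  Gamma F -> odd N -> (forall i j, Y i *m Y j = Y j *m Y i) ->
  exists2 v : 'rV_N, v != 0 & forall i, exists x, v *m Y i = x *: v.
Proof.
move=> GF odd_N commY.
pose stableY (U : 'M[F]_N) := forall i, (U *m Y i <= U)%MS.
suffices [U [stU U0 scU]] : exists U, [/\ stableY U, U != 0 &
    forall i, exists x, (U <= kermx (Y i - x%:M))%MS].
  exists (nz_row U); first by rewrite nz_row_eq0.
  move=> i; have [x /sub_kermxP Ux] := scU i; exists x.
  have /submxP[w ->] := nz_row_sub U.
  by apply/eqP; rewrite -subr_eq0 -mul_mx_scalar -mulmxBr -mulmxA Ux mulmx0.
have : stableY 1%:M by move=> i; apply: submx1.
have : odd (\rank (1%:M : 'M[F]_N)) by rewrite mxrank1.
move: (leqnn (\rank (1%:M : 'M[F]_N)).+1); move: {2}(_.+1) => n.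
elim: n (1%:M : 'M[F]_N) => // n IH U le_Un odd_U stU.
have [[i nscU] | scU] := classic (exists i, ~ exists x, (U <= kermx (Y i - x%:M))%MS); last first.
  exists U; split=> // [|i]; first by apply: contraTneq odd_U => ->; rewrite mxrank0.
  by apply: NNPP => nsc; apply: scU; exists i.
pose R := row_base U.
have /submxP[Yi DYi] : (R *m Y i <= R)%MS.
  have [sRU sUR] : (R <= U)%MS /\ (U <= R)%MS by rewrite !eq_row_base.
  exact: submx_trans (submxMr _ sRU) (submx_trans (stU i) sUR).
have [x /eigenvalueP[w wYi w0]] := Gamma_odd_eigenvalue Yi GF odd_U.
pose Z := Y i - x%:M.
have commZ j : Z *m Y j = Y j *m Z by rewrite mulmxBl mulmxBr commY scalar_mxC.
have Dr := mxrank_mul_ker U Z.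
have ker_gt0 : (0 < \rank (U :&: kermx Z))%N.
  rewrite lt0n mxrank_eq0; apply/negP=> /eqP cap0.
  have wR0 : w *m R != 0 by rewrite mulmx_free_eq0 ?row_base_free.
  case/negP: wR0; rewrite -submx0 -cap0 sub_capmx.
  rewrite (submx_trans (submxMl w R)) /R ?eq_row_base //=.
  apply/sub_kermxP; rewrite mulmxBr -mulmxA DYi mulmxA wYi mul_mx_scalar.
  by rewrite -scalemxAl subrr.
have img_gt0 : (0 < \rank (U *m Z))%N.
  rewrite lt0n mxrank_eq0; apply/eqP => /sub_kermxP UZ0.
  by apply: nscU; exists x.
have stker : stableY (U :&: kermx Z)%MS.
  move=> j; rewrite sub_capmx (submx_trans (submxMr _ (capmxSl _ _)) (stU j)) //=.
  apply/sub_kermxP; rewrite -mulmxA -commZ mulmxA.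
  by have /sub_kermxP-> := capmxSr U (kermx Z); rewrite mul0mx.
have stimg : stableY (U *m Z).
  by move=> j; rewrite -mulmxA commZ mulmxA submxMr.
have := odd_U; rewrite -Dr oddD; have [odd_img _|_ odd_ker] := boolP (odd (\rank (U *m Z))).
  by apply: IH odd_img stimg; lia.
by apply: IH odd_ker stker; lia.
Qed.

(** * Degrees of polynomial matrices *)

Section SizeMatrix.
Variable F : fieldType.
Implicit Types (p q : {poly F}).

Definition size_mx_le m n (M : 'M[{poly F}]_(m, n)) d := forall i j, (size (M i j) <= d)%N.

Lemma size_sum_le (I : Type) (r : seq I) (P : pred I) (f : I -> {poly F}) d :
  (forall i, P i -> size (f i) <= d)%N -> (size (\sum_(i <- r | P i) f i)%R <= d)%N.
Proof.
move=> le_f; elim/big_rec: _ => [|i p Pi le_p]; first by rewrite size_poly0.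
by rewrite (leq_trans (size_polyD _ _)) // geq_max le_f.
Qed.

Lemma size_mul_le p q a b :
  (size p <= a.+1 -> size q <= b.+1 -> size (p * q)%R <= (a + b).+1)%N.
Proof. by move=> pa qb; have := size_polyMleq p q; lia. Qed.

Lemma size_mulmx_le m n k (M : 'M_(m, n)) (M' : 'M_(n, k)) a b :
  size_mx_le M a.+1 -> size_mx_le M' b.+1 -> size_mx_le (M *m M') (a + b).+1.
Proof.
by move=> Ma Mb i j; rewrite mxE; apply: size_sum_le => l _; apply: size_mul_le.
Qed.

Lemma coef_mul_top p q a b :
  (size p <= a.+1)%N -> (size q <= b.+1)%N -> (p * q)`_(a + b) = p`_a * q`_b.
Proof.
move=> pa qb; rewrite coefM.
rewrite (bigD1 (inord a)) //= inordK ?ltnS ?leq_addr // addKn big1 ?addr0 // => i.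
rewrite -val_eqE /= inordK ?ltnS ?leq_addr // => ne_ia.
have [lt_ai | le_ia] := ltnP a i.
  by rewrite [p`_i]nth_default ?mul0r // (leq_trans pa).
rewrite [q`__]nth_default ?mulr0 // (leq_trans qb) //.
by have := ltn_ord i; lia.
Qed.

Lemma map_coef_mulmx m n k (M : 'M_(m, n)) (M' : 'M_(n, k)) a b :
  size_mx_le M a.+1 -> size_mx_le M' b.+1 ->
  map_mx (coefp (a + b)) (M *m M') = map_mx (coefp a) M *m map_mx (coefp b) M'.
Proof.
move=> Ma Mb; apply/matrixP=> i j; rewrite !mxE linear_sum.
by apply: eq_bigr => l _; rewrite !mxE /= coef_mul_top.
Qed.

Lemma size_det_le n (M : 'M[{poly F}]_n) b : size_mx_le M b -> (size (\det M) <= (n * b).+1)%N.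
Proof.
move=> Mb; apply: size_sum_le => s _.
rewrite -signr_odd mulr_sign; case: odd; rewrite ?size_polyN.
all: rewrite (leq_trans (size_poly_prod_leq _ _)) //.
all: rewrite (leq_trans (leq_subr _ _)) // ltnS.
all: rewrite (leq_trans (leq_sum _ (fun i _ => Mb i (s i)))) //.
all: by rewrite sum_nat_const card_ord.
Qed.

(** For [e >= N], the coefficients of degree [e] of the coefficients of [P] form a polynomial [r]
    that vanishes on all of [F], hence is zero by [Gamma_nonroot]. *)
Lemma size_coef_le (N : nat) (P : {poly {poly F}}) :
  Gamma F -> (forall x : F, size P.[x%:P] <= N)%N -> forall l, (size (P`_l)%R <= N)%N.
Proof.
move=> GF le_P l; apply/leq_sizeP => e le_Ne.
pose r := \poly_(k < size P) (P`_k)`_e.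
have r0 : r = 0.
  apply/eqP/negPn/negP=> /(Gamma_nonroot GF)[x]; case/negP.
  have /leq_sizeP/(_ e le_Ne) := le_P x.
  rewrite horner_coef coef_sum horner_poly => Dsum.
  apply/eqP; rewrite -[RHS]Dsum; apply: eq_bigr => k _.
  by rewrite -rmorphXn /= coefMC.
have [lt_l | le_l] := ltnP l (size P); last by rewrite [P`_l]nth_default // coef0.
by have := congr1 (coefp l) r0; rewrite /= coef_poly lt_l coef0.
Qed.

End SizeMatrix.

(** * Matrix pencils and maximal minors *)

Lemma adj_mulmx_det (R : comNzRingType) n (G : 'M[R]_n) (w : 'cV_n) c :
  (\adj G *m w) c 0 = \det (\matrix_(i, j) if j == c then w i 0 else G i j).
Proof.
rewrite (expand_det_col _ c) !mxE; apply: eq_bigr => i _.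
rewrite !mxE eqxx mulrC; congr (_ * (_ * \det _)).
by apply/matrixP=> k l; rewrite !mxE eq_sym (negPf (neq_lift _ _)).
Qed.

(* A maximal minor: by Cramer's rule the columns of a family are then
   combinations of the chosen ones with coefficients of degree at most 0. *)
Lemma exists_max_minor (F : fieldType) (T : finType) N (w : T -> 'cV[{poly F}]_N)
    (f0 : {ffun 'I_N -> T}) (M := fun f : {ffun 'I_N -> T} => \matrix_(i, j) w (f j) i 0) :
  \det (M f0) != 0 ->
  exists2 f, \det (M f) != 0
    & forall t, size_mx_le (\adj (M f) *m w t) (size (\det (M f))).
Proof.
move=> det0.
have [f _ max_f] := @arg_maxnP _ f0 xpredT (fun f => size (\det (M f))) isT.
exists f => [|t i j].
  by rewrite -size_poly_gt0 (leq_trans _ (max_f f0 isT)) // size_poly_gt0.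
rewrite ord1 adj_mulmx_det.
pose g := [ffun k => if k == i then t else f k].
have -> : \matrix_(k, l) (if l == i then w t k 0 else M f k l) = M g; last exact: max_f.
by apply/matrixP=> k l; rewrite !mxE ffunE; case: ifP.
Qed.

Lemma det_adj (R : idomainType) N (B : 'M[R]_N.+1) :
  \det B != 0 -> \det (\adj B) = \det B ^+ N.
Proof.
by move=> u0; apply: (mulfI u0); rewrite -det_mulmx mul_mx_adj det_scalar exprS.
Qed.

Lemma comm_adj (R : idomainType) N (A B : 'M[R]_N.+1) :
  \det B != 0 -> A * B = B * A -> A * \adj B = \adj B * A.
Proof.
move=> u0 cAB; have : \det B *: (A * \adj B) = \det B *: (\adj B * A).
  transitivity (\adj B *m (B *m A) *m \adj B).
    by rewrite mulmxA mul_adj_mx mul_scalar_mx -scalemxAl.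
  have cBA : B *m A = A *m B := esym cAB.
  by rewrite cBA -!mulmxA mul_mx_adj mul_mx_scalar -scalemxAr.
by move/matrixP=> eqAB; apply/matrixP=> i j; have := eqAB i j; rewrite !mxE => /(mulfI u0).
Qed.

(** Both sides are the determinant of [('X B - A) \adj B], which is [\det B 'X - A \adj B]. *)
Lemma adj_pencil_char (R : comNzRingType) N (A B : 'M[R]_N) :
  char_poly (A *m \adj B) \Po ((\det B)%:P * 'X) =
    \det ('X *: map_mx polyC B - map_mx polyC A) * (\det (\adj B))%:P.
Proof.
rewrite -(det_map_mx polyC (\adj B)) -det_mulmx /char_poly.
rewrite -[_ \Po _]/(comp_poly _ _) -det_map_mx; congr (\det _).
rewrite mulmxBl -scalemxAl -!map_mxM mul_mx_adj.
apply/matrixP=> i j; rewrite !mxE rmorphB /= comp_polyC rmorphMn /= comp_polyX.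
by case: eqP; rewrite ?(mulr1n, mulr0n) ?mulr0 // mulrC.
Qed.

Lemma coef_comp_polyCX (R : comNzRingType) (p : {poly R}) c l :
  (p \Po (c%:P * 'X))`_l = p`_l * c ^+ l.
Proof.
rewrite coef_comp_poly.
have [lt_l | le_l] := ltnP l (size p); last first.
  rewrite nth_default // mul0r big1 // => k _.
  by rewrite exprMn -rmorphXn coefCM coefXn gtn_eqF ?mulr0 // (leq_trans (ltn_ord k)).
rewrite (bigD1 (Ordinal lt_l)) //= exprMn -rmorphXn coefCM coefXn eqxx mulr1.
rewrite big1 ?addr0 // => k ne_kl; rewrite exprMn -rmorphXn coefCM coefXn.
by rewrite -[l == k]/(Ordinal lt_l == k :> 'I_ _) eq_sym (negPf ne_kl) !mulr0.
Qed.

Lemma adj_pencil_power (R : idomainType) N (A B A' : 'M[R]_N.+1) (u : R) (b : {poly R}) :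
  b = \det ('X *: map_mx polyC B - map_mx polyC A) -> u = \det B -> A' = A *m \adj B ->
  u != 0 -> A' ^+ N.+1 = \sum_(l < N.+1) (- b`_l * u ^+ (N - l)) *: A' ^+ l.
Proof.
move=> Db Du DA' u0.
have b_char : char_poly A' \Po (u%:P * 'X) = b * (u ^+ N)%:P.
  by rewrite DA' Db Du adj_pencil_char det_adj -?Du.
have Dchi_u l : (char_poly A')`_l * u ^+ l = b`_l * u ^+ N.
  by rewrite -coef_comp_polyCX b_char coefMC.
have Dchi l : (l <= N)%N -> (char_poly A')`_l = b`_l * u ^+ (N - l).
  by move=> le_lN; apply: (mulIf (expf_neq0 l u0)); rewrite Dchi_u -mulrA -exprD subnK.
have lead_chi : (char_poly A')`_N.+1 = 1.
  by have := char_poly_monic A'; rewrite monicE lead_coefE size_char_poly => /eqP.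
have := Cayley_Hamilton A'.
have sz_chi : (size (map_poly (@scalar_mx R N.+1) (char_poly A')) <= N.+2)%N.
  by rewrite (leq_trans (size_poly _ _)) ?size_char_poly.
rewrite /horner_mx /= /horner_morph (horner_coef_wide _ sz_chi) big_ord_recr /=.
rewrite coef_map /= lead_chi mul1r addrC => /(canRL (addrK _)); rewrite add0r => ->.
rewrite -sumrN; apply: eq_bigr => l _; rewrite coef_map /= Dchi -1?ltnS //.
by rewrite mulNr scaleNr -mul_scalar_mx.
Qed.

(* [A \adj B] is [u A B^-1], so this says that [A B^-1] is integral over the
   valuation ring at infinity. *)
Lemma adj_pencil_relation (F : fieldType) N (A B : 'M[{poly F}]_N.+1)
    (u := \det B) (A' := A * \adj B) :
  Gamma F -> u != 0 -> A * B = B * A ->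
  (forall x : F, size (\det (x%:P *: B - A)) <= size u)%N ->
  exists2 g : 'I_N.+1 -> {poly F}, (forall l, size (g l) <= size u)%N &
    A' ^+ N.+1 = \sum_(l < N.+1) (g l * u ^+ (N - l)) *: A' ^+ l.
Proof.
move=> GF u0 cAB le_u.
pose b : {poly {poly F}} := \det ('X *: map_mx polyC B - map_mx polyC A).
have le_b : forall l, (size (b`_l)%R <= size u)%N.
  apply: (size_coef_le GF) => x; rewrite -[b.[_]]/(horner_eval _ b) -det_map_mx.
  rewrite (_ : map_mx _ _ = x%:P *: B - A) //.
  by apply/matrixP=> i j; rewrite !mxE /= /horner_eval hornerD hornerN hornerM hornerX !hornerC.
exists (fun l => - b`_l) => [l|]; first by rewrite size_polyN.
exact: (@adj_pencil_power _ _ A B).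
Qed.

(** * Quadratic relations between matrices *)

(** The quadratic operator with structure constants [v], evaluated in any algebra, so that one
    formula serves matrices over [F] and over [{poly F}]. *)
Definition quad (R : nzRingType) (A : lalgType R) n (v : 'I_n -> 'I_n -> 'I_n -> R)
  (x : 'I_n -> A) j : A := \sum_k \sum_l v j k l *: (x k * x l).

(** As [a] commutes with all factors, it can be moved next to the factor of index [i], the only one
    that changes. This describes the action of [A i * \adj B] on the generators of the lattice. *)
Lemma mul_prod_shift (R : comNzRingType) (M : algType R) (I : eqType) (J : finType)
    (h : I -> J -> M) (a : M) (i : I) (g : J -> J -> R) :
  (forall k l, a * h k l = h k l * a) ->
  (forall l, a * h i l = \sum_l' g l l' *: h i l') ->
  forall (s : seq I) (al : I -> J), uniq s -> i \in s ->
  a * \prod_(k <- s) h k (al k) =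
    \sum_l' g (al i) l' *: \prod_(k <- s) h k (if k == i then l' else al k).
Proof.
move=> comm_a shift_a; elim=> // k s IH al /= /andP[k's Us]; rewrite inE big_cons.
have [Dk _ | ne_ik /= i_s] := eqVneq i k.
  rewrite -{}Dk in k's *.
  rewrite mulrA shift_a mulr_suml; apply: eq_bigr => l' _.
  rewrite big_cons eqxx scalerAl; congr (_ * _).
  by apply: eq_big_seq => k' s_k'; case: eqP s_k' k's => // -> ->.
rewrite mulrA comm_a -mulrA IH // mulr_sumr; apply: eq_bigr => l' _.
by rewrite big_cons eq_sym (negPf ne_ik) -scalerAr.
Qed.

Section Top.
Variables (F : fieldType) (N n : nat) (v : 'I_n -> 'I_n -> 'I_n -> F).
Implicit Types P : 'I_n -> 'M[{poly F}]_N.+1.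

Definition polyv j k l := (v j k l)%:P.

Lemma map_coef_scale m1 m2 d (a : F) (M : 'M[{poly F}]_(m1, m2)) :
  map_mx (coefp d) (a%:P *: M) = a *: map_mx (coefp d) M.
Proof. by apply/matrixP=> i j; rewrite !mxE /= coefCM. Qed.

Lemma map_coef_X m1 m2 d (M : 'M[{poly F}]_(m1, m2)) :
  map_mx (coefp d.+1) ('X *: M) = map_mx (coefp d) M.
Proof. by apply/matrixP=> i j; rewrite !mxE /= coefXM. Qed.

Lemma map_coef_small m1 m2 d (M : 'M[{poly F}]_(m1, m2)) :
  size_mx_le M d -> map_mx (coefp d) M = 0.
Proof. by move=> Md; apply/matrixP=> i j; rewrite !mxE /= nth_default. Qed.

Lemma size_quad_le P d : (forall i, size_mx_le (P i) d.+1) ->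
  forall j, size_mx_le (quad polyv P j) (d + d).+1.
Proof.
move=> le_P j r c; rewrite /quad summxE; apply: size_sum_le => k _.
rewrite summxE; apply: size_sum_le => l _; rewrite mxE -[(d + d)%N]add0n.
by apply: size_mul_le; [exact: size_polyC_leq1 | apply: size_mulmx_le].
Qed.

Lemma map_coef_quad P d : (forall i, size_mx_le (P i) d.+1) ->
  forall j, map_mx (coefp (d + d)) (quad polyv P j) = quad v (fun i => map_mx (coefp d) (P i)) j.
Proof.
move=> le_P j; rewrite /quad raddf_sum; apply: eq_bigr => k _.
rewrite raddf_sum; apply: eq_bigr => l _; apply: etrans (map_coef_scale _ _ _) _; congr (_ *: _).
exact: map_coef_mulmx.
Qed.

(** Compare the coefficients of degree [3 d + 1]: the products [P i * P j ^+ 2] have degree at most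
    [3 d], so only the terms with [quad] contribute. *)
Lemma top_quad_relation P d : (forall i, size_mx_le (P i) d.+1) ->
  (forall i j, P i * (P j ^+ 2 + 'X *: quad polyv P j) =
               P j * (P i ^+ 2 + 'X *: quad polyv P i)) ->
  forall i j (T := fun i => map_mx (coefp d) (P i)),
  T i * quad v T j = T j * quad v T i.
Proof.
move=> le_P relP i j T.
have top i' j' : map_mx (coefp (d + (d + d)).+1)
    (P i' * (P j' ^+ 2 + 'X *: quad polyv P j')) = T i' * quad v T j'.
  rewrite -(map_coef_quad le_P) -[RHS]map_coef_mulmx //; last exact: size_quad_le.
  rewrite mulrDr -scalerAr map_mxD map_coef_X [X in X + _]map_coef_small ?add0r // => r c.
  by apply: (size_mulmx_le (le_P i')) => // k l; rewrite expr2; apply: size_mulmx_le.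
by rewrite -!top relP.
Qed.

End Top.

Lemma quad_mul_comm (R : comNzRingType) (M : algType R) n (v : 'I_n -> 'I_n -> 'I_n -> R)
  (x : 'I_n -> M) (e : M) : (forall i, x i * e = e * x i) ->
  forall j, quad v (fun i => x i * e) j = quad v x j * e ^+ 2.
Proof.
move=> xe j; rewrite /quad mulr_suml; apply: eq_bigr => k _.
rewrite mulr_suml; apply: eq_bigr => l _; rewrite -scalerAl expr2; congr (_ *: _).
by rewrite -!mulrA; congr (_ * _); rewrite !mulrA xe.
Qed.

(** Both sides are homogeneous of degree 3 in [x], so a commuting [e] comes out as [e ^+ 3]. *)
Lemma quad_relation_mul (R : comNzRingType) (M : algType R) n (v : 'I_n -> 'I_n -> 'I_n -> R)
    (x : 'I_n -> M) (e : M) (t : R) : (forall i, x i * e = e * x i) ->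
  (forall i j, x i * (x j ^+ 2 + t *: quad v x j) = x j * (x i ^+ 2 + t *: quad v x i)) ->
  forall i j (y := fun i => x i * e),
  y i * (y j ^+ 2 + t *: quad v y j) = y j * (y i ^+ 2 + t *: quad v y i).
Proof.
move=> xe rel i j y.
have ee i' : GRing.comm e (x i') by rewrite /GRing.comm xe.
have yE i' j' (q := x j' ^+ 2 + t *: quad v x j') :
    y i' * (y j' ^+ 2 + t *: quad v y j') = x i' * q * e ^+ 3.
  have eq : GRing.comm e q.
    apply: commrD; first exact: commrX.
    rewrite /GRing.comm -scalerAr -scalerAl; congr (_ *: _).
    apply: commr_sum => k _; apply: commr_sum => l _.
    by rewrite /GRing.comm -scalerAr -scalerAl; congr (_ *: _); apply: commrM.
  rewrite quad_mul_comm // /y exprMn_comm ?/GRing.comm // scalerAl -mulrDl -/q.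
  by rewrite exprS -!mulrA; congr (_ * _); rewrite !mulrA eq.
by rewrite !yE rel.
Qed.


(* [\adj G * x * G] is a conjugate of [x], up to the scalar [\det G]. *)
Lemma quad_relation_conj (R : comNzRingType) N n (v : 'I_n -> 'I_n -> 'I_n -> R)
    (x : 'I_n -> 'M[R]_N.+1) (G : 'M[R]_N.+1) (t : R) :
  (forall i j, x i * (x j ^+ 2 + t *: quad v x j) = x j * (x i ^+ 2 + t *: quad v x i)) ->
  forall i j (y := fun i => \adj G * x i * G),
  y i * (y j ^+ 2 + t *: quad v y j) = y j * (y i ^+ 2 + t *: quad v y i).
Proof.
move=> rel i j y; pose D := \det G.
have conjM a b : (\adj G * a * G) * (\adj G * b * G) = D *: (\adj G * (a * b) * G).
  have GG : G * \adj G = D *: 1 by rewrite [LHS]mul_mx_adj -scalemx1.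
  by rewrite -!mulrA (mulrA G) GG -!scalerAl mul1r -!scalerAr.
have yE i' j' : y i' * (y j' ^+ 2 + t *: quad v y j') =
    D ^+ 2 *: (\adj G * (x i' * (x j' ^+ 2 + t *: quad v x j')) * G).
  have -> : y j' ^+ 2 + t *: quad v y j' = D *: (\adj G * (x j' ^+ 2 + t *: quad v x j') * G).
    rewrite mulrDr mulrDl scalerDr expr2 conjM -expr2; congr (_ + _).
    rewrite -scalerAr -scalerAl !scalerA mulrC -scalerA; congr (_ *: _).
    rewrite /quad mulr_sumr mulr_suml scaler_sumr; apply: eq_bigr => k _.
    rewrite mulr_sumr mulr_suml scaler_sumr; apply: eq_bigr => l _.
    by rewrite conjM -scalerAr -scalerAl !scalerA mulrC.
  by rewrite -scalerAr conjM scalerA -expr2.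
by rewrite !yE rel.
Qed.

(** * Specialization at infinity *)

Lemma exists_max_size (F : fieldType) (T : Type) (f : T -> {poly F}) (x0 : T) b :
  (forall x, size (f x) <= b)%N -> exists x, forall y, (size (f y) <= size (f x))%N.
Proof.
move=> le_b; have : (b - size (f x0) < (b - size (f x0)).+1)%N by [].
move: {2}(_.+1) => k; elim: k x0 => // k IH x lt_k.
have [[y lt_xy] | nex] := classic (exists y, size (f x) < size (f y))%N.
  by apply: (IH y); have := le_b y; lia.
by exists x => y; rewrite leqNgt; apply/negP=> lt_xy; apply: nex; exists y.
Qed.

Section Lattice.
Variables (F : fieldType) (N n : nat) (A : 'I_n -> 'M[{poly F}]_N.+1).
Variables (B : 'M[{poly F}]_N.+1).
Hypothesis GF : Gamma F.
Hypothesis commA : forall i j, A i * A j = A j * A i.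
Hypothesis commB : forall i, A i * B = B * A i.
Hypothesis detB : \det B != 0.
Hypothesis le_det : forall i (x : F), (size (\det (x%:P *: B - A i)) <= size (\det B))%N.

(* The columns of [G] span the lattice generated over the valuation ring at
   infinity by the monomials in the [A_i B^-1] with exponents at most [N]; they
   are [N + 1] generators with determinant of maximal degree, and integrality of
   the [A_i B^-1] makes the lattice stable. *)
Lemma exists_lattice : exists2 G : 'M[{poly F}]_N.+1, \det G != 0 &
  forall i, size_mx_le (\adj G * (A i * \adj B) * G) ((size (\det B)).-1 + (size (\det G)).-1).+1.
Proof.
pose u := \det B; pose A' i := A i * \adj B.
have commA' i j : A' i * A' j = A' j * A' i.
  rewrite /A' -!mulrA (mulrA (\adj B)) (mulrA (\adj B) (A i)).
  by rewrite -!comm_adj // !mulrA commA.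
have /fin_all_exists[g Dg] : forall i, exists g : 'I_N.+1 -> {poly F},
    (forall l, size (g l) <= size u)%N /\
    A' i ^+ N.+1 = \sum_(l < N.+1) (g l * u ^+ (N - l)) *: A' i ^+ l.
  move=> i; have [g le_g Dg] := adj_pencil_relation GF detB (commB i) (le_det i).
  by exists g.
(* As [A' i] is [u A_i B^-1], [h i l] is [u^N (A_i B^-1)^l], free of denominators. The entries of
   [c] give multiplication by [A' i]: a shift for [l < N], the integral relation for [l = N]. *)
pose h i (l : 'I_N.+1) := u ^+ (N - l) *: A' i ^+ l.
pose c i (l l' : 'I_N.+1) := if (l < N)%N then (if l' == l.+1 :> nat then u else 0) else g i l'.
have h_comm i k l : A' i * h k l = h k l * A' i.
  rewrite -scalerAr -scalerAl; congr (_ *: _).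
  by apply/commrX/commA'.
have h_shift i l : A' i * h i l = \sum_l' c i l l' *: h i l'.
  rewrite /c; case: ltnP => [lt_lN | le_Nl].
    have lt_l1 : (l.+1 < N.+1)%N by [].
    rewrite (bigD1 (Ordinal lt_l1)) //= eqxx big1 ?addr0 => [|l' ne_l'].
      rewrite -scalerAr -exprS scalerA -exprS; by rewrite [(N - Ordinal _)%N]/= subnSK.
    by rewrite -[_ == _ :> nat]/(l' == Ordinal lt_l1) (negPf ne_l') scale0r.
  have -> : l = ord_max by apply: val_inj; apply/eqP; rewrite eqn_leq -ltnS ltn_ord.
  rewrite -scalerAr -exprS subnn expr0 scale1r (Dg i).2.
  by apply: eq_bigr => l' _; rewrite scalerA.
pose w (t : {ffun 'I_n -> 'I_N.+1} * 'I_N.+1) := col t.2 (\prod_(k < n) h k (t.1 k)).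
pose t0 : {ffun 'I_n -> 'I_N.+1} := [ffun=> ord0].
pose M (f : {ffun 'I_N.+1 -> {ffun 'I_n -> 'I_N.+1} * 'I_N.+1}) := \matrix_(i, j) w (f j) i 0.
have det0 : \det (M [ffun j => (t0, j)]) != 0.
  have -> : M [ffun j => (t0, j)] = (\prod_(k < n) u ^+ N)%:M.
    rewrite (rmorph_prod (@scalar_mx _ N.+1)); apply/matrixP=> i j.
    rewrite mxE ffunE /w /= mxE; congr (fun_of_matrix _ i j); apply: eq_bigr => k _.
    by rewrite ffunE /h subn0 expr0 scalemx1.
  by rewrite det_scalar expf_neq0 // prodf_seq_neq0; apply/allP=> k _; rewrite expf_neq0.
have [f detf max_f] := exists_max_minor det0.
exists (M f) => // i r j; rewrite -/(A' i).
have col_mul k (X Y : 'M[{poly F}]_N.+1) : col k (X *m Y) = X *m col k Y by rewrite !colE mulmxA.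
have Dw : w (f j) = col j (M f) by apply/colP=> k; rewrite !mxE.
rewrite -mulrA.
have -> : (\adj (M f) * (A' i * M f)) r j = (\adj (M f) *m (A' i *m w (f j))) r 0.
  by rewrite Dw -!col_mul [RHS]mxE.
case: (f j) => al j'; rewrite /w /= -col_mul.
(* [A' i] sends a generator to a combination of generators with coefficients of size at most
   [size u]; maximality of the minor bounds the coordinates of each generator. *)
have := mul_prod_shift (h_comm i) (h_shift i) al (index_enum_uniq _) (mem_index_enum i).
rewrite -mulmxE => ->; rewrite linear_sum mulmx_sumr summxE; apply: size_sum_le => l _.
rewrite linearZ -scalemxAr mxE; apply: size_mul_le.
  rewrite prednK ?size_poly_gt0 // /c; case: ifP => // _; last exact: (Dg i).1.
  by case: ifP; rewrite ?size_poly0.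
rewrite prednK ?size_poly_gt0 //.
pose al' := [ffun k => if k == i then l else al k].
rewrite (eq_bigr (fun k => h k (al' k))) => [|k _]; last by rewrite ffunE.
exact: (max_f (al', j')).
Qed.

End Lattice.

(** [Y i] is the value at infinity of [A_i B^-1] written in the basis [G]: the coefficient of degree
    [d] of [P i], divided by [q]. Since [B] is the combination of the [A i] with weights [a i], the
    [Y i] combine to 1. *)
Lemma odd_pencil_limit (F : fieldType) N n (v : 'I_n -> 'I_n -> 'I_n -> F)
    (A : 'I_n -> 'M[{poly F}]_N.+1) (c : 'I_n -> F) :
  Gamma F -> (forall i j, A i * A j = A j * A i) ->
  (forall i j, A i * (A j ^+ 2 + 'X *: quad (polyv v) A j) =
               A j * (A i ^+ 2 + 'X *: quad (polyv v) A i)) ->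
  \det (\sum_i (c i)%:P *: A i) != 0 ->
  exists (a : 'I_n -> F) (Y : 'I_n -> 'M[F]_N.+1),
    [/\ forall i j, Y i * Y j = Y j * Y i, \sum_i a i *: Y i = 1
      & forall i j, Y i * quad v Y j = Y j * quad v Y i].
Proof.
move=> GF commA relA detc.
pose S (a : 'I_n -> F) := \sum_i (a i)%:P *: A i.
pose b := \max_i \max_r \max_k size (A i r k).
have le_b a : (size (\det (S a)) <= (N.+1 * b).+1)%N.
  apply: size_det_le => r k; rewrite summxE; apply: size_sum_le => i _.
  rewrite mxE mul_polyC (leq_trans (size_scale_leq _ _)) //.
  rewrite (leq_trans _ (leq_bigmax i)) // (leq_trans _ (leq_bigmax r)) //.
  exact: (leq_bigmax k).
(* With this choice of [a] the [A_i B^-1] have no pole at infinity. *)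
have [a max_a] := exists_max_size c le_b; pose B := S a; pose u := \det B.
have u0 : u != 0.
  by rewrite -size_poly_gt0 (leq_trans _ (max_a c)) // size_poly_gt0.
have commB i : A i * B = B * A i.
  rewrite mulr_sumr mulr_suml; apply: eq_bigr => j _.
  by rewrite -scalerAr -scalerAl commA.
have [|G detG le_P] := exists_lattice GF commA commB u0.
  (* [x B - A i] is again a combination of the [A k], so the choice of [a] bounds its
     determinant. *)
  move=> i x; pose ai k := x * a k - (k == i)%:R.
  have Sai : S ai = x%:P *: B - A i; last by rewrite -Sai; apply: max_a.
  rewrite /S /ai (eq_bigr (fun k =>
    x%:P *: ((a k)%:P *: A k) - (k == i)%:R%:P *: A k)) => [|k _]; last first.
    by rewrite polyCB polyCM scalerBl scalerA.
  rewrite sumrB -scaler_sumr; congr (_ - _); rewrite (bigD1 i) //= eqxx scale1r big1 ?addr0 // => k /negPf->.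
  by rewrite polyC0 scale0r.
pose A' i := A i * \adj B; pose P i := \adj G * A' i * G.
set d := addn _ _ in le_P; pose T i := map_mx (coefp d) (P i).
(* [q] is the coefficient of degree [d] of [u * \det G], the scalar obtained by summing the [P i]
   with weights [a i]. *)
pose q := lead_coef u * lead_coef (\det G).
have q0 : q != 0 by rewrite mulf_neq0 ?lead_coef_eq0.
have commBA i : A i * \adj B = \adj B * A i by apply: comm_adj.
have relP := quad_relation_conj G (quad_relation_mul commBA relA).
have relT := top_quad_relation le_P relP.
have commT i j : T i * T j = T j * T i.
  have mulP k l : P k * P l = \det G *: (\adj G * (A' k * A' l) * G).
    have GG : G * \adj G = \det G *: 1 by rewrite [LHS]mul_mx_adj -scalemx1.
    by rewrite /P -!mulrA (mulrA G) GG -!scalerAl mul1r -!scalerAr.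
  rewrite /T -[LHS](map_coef_mulmx (le_P i) (le_P j)) -[RHS](map_coef_mulmx (le_P j) (le_P i)).
  congr (map_mx _ _); rewrite [LHS]mulP [RHS]mulP; congr (_ *: (_ * _ * _)).
  rewrite /A' -!mulrA (mulrA (\adj B)) (mulrA (\adj B) (A i)).
  by rewrite -!commBA !mulrA commA.
have sumT : \sum_i a i *: T i = q *: 1.
  have PE : \sum_i (a i)%:P *: P i = (u * \det G) *: 1.
    rewrite (eq_bigr (fun i => \adj G * ((a i)%:P *: A i * \adj B) * G)); last first.
      by move=> i _; rewrite /P /A' -!scalerAl -scalerAr -scalerAl.
    rewrite -mulr_suml -mulr_sumr -mulr_suml -/(S a) -/B [B * _]mul_mx_adj.
    by rewrite -[_%:M]scalemx1 -scalerAr mulr1 -scalerAl [_ * G]mul_adj_mx -scalemx1 scalerA.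
  rewrite -(eq_bigr _ (fun i _ => map_coef_scale _ _ _)) -raddf_sum PE.
  apply/matrixP=> r k; rewrite !mxE /= !mulr_natr coefMn; congr (_ *+ _).
  by apply: coef_mul_top; rewrite prednK ?size_poly_gt0.
exists a, (fun i => q^-1 *: T i); split=> [i j | | i j].
- by rewrite -!scalerAl -!scalerAr commT.
- rewrite (eq_bigr (fun i => q^-1 *: (a i *: T i))) => [|i _]; last by rewrite !scalerA mulrC.
  by rewrite -scaler_sumr sumT scalerA mulVf // scale1r.
have quadZ k : quad v (fun i => q^-1 *: T i) k = q^-1 ^+ 2 *: quad v T k.
  rewrite /quad scaler_sumr; apply: eq_bigr => l _; rewrite scaler_sumr; apply: eq_bigr => m _.
  by rewrite -scalerAl -scalerAr !scalerA; congr (_ *: _); rewrite [RHS]mulrC expr2 !mulrA.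
by rewrite !quadZ -!scalerAl -!scalerAr relT.
Qed.

(** * Solutions of the deformed system modulo powers of [s] *)

Lemma dvdp_sum (F : fieldType) (I : Type) (r : seq I) (P : pred I) (f : I -> {poly F}) d :
  (forall i, P i -> d %| f i) -> d %| \sum_(i <- r | P i) f i.
Proof. by move=> df; elim/big_rec: _ => [|i p Pi dp]; rewrite ?dvdp0 ?dvdp_add ?df. Qed.

Section Newton.
Variables (F : fieldType) (n : nat) (v : 'I_n -> 'I_n -> 'I_n -> F).
Implicit Types (z : 'I_n -> {poly F}) (d : {poly F}).

Definition qpoly z j : {poly F} := \sum_k \sum_l polyv v j k l * (z k * z l).

Definition defect z i : {poly F} := z i ^+ 2 - z i + 'X * qpoly z i.

Lemma dvdpX_root (p : {poly F}) : ('X %| p) = (p.[0] == 0).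
Proof. by rewrite -[X in X %| _]subr0 -polyC0 dvdp_XsubCl. Qed.

(** Newton iteration from the vertex [J] of the cube, where the derivative [2 z_i - 1] is [1] or
    [-1], hence its own inverse. *)
Lemma newton_solution (J : {set 'I_n}) m :
  exists2 z : 'I_n -> {poly F}, forall i, (z i).[0] = (i \in J)%:R & forall i, 'X^(m.+1) %| defect z i.
Proof.
elim: m => [|m [z z0 dz]].
  exists (fun i => (i \in J)%:R%:P) => [i|i]; first by rewrite hornerC.
  rewrite /defect expr1; apply: dvdp_add; last exact: dvdp_mulIl.
  by case: (i \in J); rewrite ?expr1n ?expr0n ?subrr ?dvdp0.
(* [s i] inverts the derivative [2 z_i - 1] modulo ['X]. *)
pose s i : {poly F} := if i \in J then 1 else -1.
have s2 i : s i ^+ 2 = 1 by rewrite /s; case: (i \in J); rewrite ?sqrrN expr1n.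
pose z' i := z i - s i * defect z i.
have dvd_z i : 'X^(m.+1) %| z' i - z i.
  by rewrite /z' addrAC subrr add0r dvdpNr dvdp_mull.
exists z' => i.
  have /eqP dz0 : (defect z i).[0] == 0.
    by rewrite -dvdpX_root (dvdp_trans _ (dz i)) // exprS dvdp_mulIl.
  by rewrite /z' hornerD hornerN hornerM dz0 mulr0 subr0 z0.
(* Each term is divisible by ['X^(m.+2)]: in the first, ['X] divides the second factor; the square
   has order at least [2 (m + 1)]; in the last, [z'] and [z] agree modulo ['X^(m.+1)]. *)
have -> : defect z' i = defect z i * (1 - s i * (z i *+ 2 - 1)) + defect z i ^+ 2
    + 'X * (qpoly z' i - qpoly z i).
  have -> : defect z' i = (z i - s i * defect z i) ^+ 2 - (z i - s i * defect z i)
    + 'X * qpoly z' i by [].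
  have -> : (z i - s i * defect z i) ^+ 2 = z i ^+ 2 - s i * defect z i * z i *+ 2 + s i ^+ 2 * defect z i ^+ 2.
    by ring.
  have : defect z i = z i ^+ 2 - z i + 'X * qpoly z i by [].
  rewrite s2; move: (defect z i) (qpoly z i) (qpoly z' i) => h q q' ->; ring.
apply: dvdp_add; [apply: dvdp_add|].
- rewrite exprSr dvdp_mul // dvdpX_root -polyC1 !(hornerD, hornerN, hornerM, hornerMn, hornerC) z0 /s.
  by case: (i \in J); rewrite -?polyC1 ?hornerN hornerC /=; apply/eqP; ring.
- rewrite expr2; apply: dvdp_trans (dvdp_mul (dz i) (dz i)).
  by rewrite -exprD dvdp_exp2l // addSn ltnS addnS ltnS leq_addr.
rewrite [X in X %| _]exprS dvdp_mul // /qpoly -sumrB; apply: dvdp_sum => k _.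
rewrite -sumrB; apply: dvdp_sum => l _; rewrite -mulrBr dvdp_mull //.
have -> : z' k * z' l - z k * z l = (z' k - z k) * z' l + z k * (z' l - z l) by ring.
by apply: dvdp_add; [apply: dvdp_mulr | apply: dvdp_mull].
Qed.
End Newton.

Lemma horner_det (F : fieldType) N (M : 'M[{poly F}]_N) x :
  (\det M).[x] = \det (map_mx (horner_eval x) M).
Proof. by rewrite det_map_mx. Qed.

(* Modulo ['X], the matrix [1 - Q] is unitriangular for the grading [deg]. *)
Lemma triangular_reduction (F : fieldType) (T : finType) (deg : T -> nat) (nf : pred T)
    (Q : T -> T -> {poly F}) :
  (forall w w', (Q w w').[0] != 0 -> (deg w' < deg w)%N) ->
  exists2 delta : {poly F}, delta.[0] != 0 & exists R : T -> T -> {poly F},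
    forall (d : {poly F}) (x : T -> {poly F}),
      (forall w, d %| x w - \sum_w' Q w w' * x w' - (nf w)%:R * x w) ->
      forall w, d %| delta * x w - \sum_(w' | nf w') R w w' * x w'.
Proof.
move=> Qdeg.
pose C : 'M[{poly F}]_#|T| := \matrix_(r, c) ((r == c)%:R - Q (enum_val r) (enum_val c)).
exists (\det C).
  rewrite horner_det -det_tr; apply/det0P=> -[u u0 uC]; case/eqP: u0.
  have ker (w : T) : u 0 (enum_rank w) = \sum_w' (Q w w').[0] * u 0 (enum_rank w').
    have /rowP/(_ (enum_rank w)) := uC; rewrite !mxE (reindex _ (onW_bij _ (@enum_rank_bij T))) /=.
    rewrite (eq_bigr (fun w' => (w == w')%:R * u 0 (enum_rank w') - (Q w w').[0] * u 0 (enum_rank w'))).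
      rewrite sumrB (bigD1 w) //= eqxx mul1r big1 ?addr0 => [/eqP|w' /negPf]; first by rewrite subr_eq0 => /eqP.
      by rewrite eq_sym => ->; rewrite mul0r.
    move=> w' _; rewrite !mxE /= /horner_eval !enum_rankK (inj_eq enum_rank_inj) -mulrBl mulrC.
    by rewrite hornerD hornerN -polyC_natr hornerC.
  suffices u0 k w : (deg w < k)%N -> u 0 (enum_rank w) = 0.
    by apply/rowP=> r; rewrite mxE -(enum_valK r) (u0 (deg (enum_val r)).+1).
  elim: k w => // k IH w lt_wk; rewrite ker big1 // => w' _.
  have [-> | /Qdeg lt_w] := eqVneq (Q w w').[0] 0; first by rewrite mul0r.
  by rewrite IH ?mulr0 //; apply: leq_trans lt_w _.
exists (fun w w' => \adj C (enum_rank w) (enum_rank w')) => d x dx w.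
pose X : 'cV[{poly F}]_#|T| := \col_r x (enum_val r).
have -> : \det C * x w = \sum_w' \adj C (enum_rank w) (enum_rank w') *
    (x w' - \sum_w'' Q w' w'' * x w'').
  have : (\adj C *m (C *m X)) (enum_rank w) 0 = \det C * x w.
    by rewrite mulmxA mul_adj_mx mul_scalar_mx !mxE enum_rankK.
  move=> <-; rewrite mxE (reindex _ (onW_bij _ (@enum_rank_bij T))) /=.
  apply: eq_bigr => w' _; congr (_ * _).
  rewrite mxE (reindex _ (onW_bij _ (@enum_rank_bij T))) /=.
  rewrite (eq_bigr (fun w'' => (w' == w'')%:R * x w'' - Q w' w'' * x w'')).
    rewrite sumrB (bigD1 w') //= eqxx mul1r big1 ?addr0 // => w'' /negPf.
    by rewrite eq_sym => ->; rewrite mul0r.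
  by move=> w'' _; rewrite !mxE !enum_rankK (inj_eq enum_rank_inj) -mulrBl.
rewrite [X in _ - X]big_mkcond -sumrB; apply: dvdp_sum => w' _.
have := dvdp_mull (\adj C (enum_rank w) (enum_rank w')) (dx w').
by rewrite mulrBr; case: (nf w'); rewrite ?mul1r // mul0r mulr0.
Qed.

(** * Reduction to squarefree monomials *)

Section Words.
Variables (F : fieldType) (n : nat) (v : 'I_n -> 'I_n -> 'I_n -> F).
Implicit Types (z : 'I_n -> {poly F}) (I : {set 'I_n}).

(** One slot per index and the extra slot [None], each empty or holding a letter. The extra slot
    makes room for multiplying a squarefree monomial by one letter, and reduction stays in this
    finite type. *)
Definition word := {ffun option 'I_n -> option 'I_n}.
Implicit Types w : word.

Definition letter z (o : option 'I_n) : {poly F} := if o is Some i then z i else 1.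
(* The empty word gets the value 0, so as to work in the ideal of the origin. *)
Definition word_val z w : {poly F} :=
  if [exists r, w r != None] then \prod_r letter z (w r) else 0.
Definition word_deg w := #|[pred r | w r != None]|.
Definition squarefree w := [forall p, forall q, (p != q) && (w p != None) ==> (w p != w q)].
Definition letters w := [set i | [exists r, w r == Some i]].
Definition monom z I := \prod_(k in I) z k.

(* A repeated letter is removed with [z_i^2 = z_i - 'X * V_i(z)]. *)
Lemma word_reduction w : exists Q : word -> {poly F},
  (forall w', (Q w').[0] != 0 -> (word_deg w' < word_deg w)%N) /\
  forall z d, (forall i, d %| defect v z i) ->
    d %| word_val z w - \sum_w' Q w' * word_val z w' - (squarefree w)%:R * word_val z w.
Proof.
have [nf_w | /forallPn[p /forallPn[q]]] := boolP (squarefree w).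
  exists (fun=> 0); split=> [w'|z d _]; first by rewrite horner0 eqxx.
  by rewrite big1 => [|w' _]; rewrite ?mul0r // subr0 mul1r subrr dvdp0.
rewrite negb_imply negbK => /andP[/andP[ne_pq]]; case Dwp: (w p) => [i|] // _ /eqP Dwq.
(* The two slots holding [z_i] are rewritten: [del] stands for [z_i] and lowers the degree,
   [sub k l] stands for [z_k z_l] and comes with a factor ['X]. *)
pose del : word := [ffun r => if r == q then None else w r].
pose sub k l : word := [ffun r => if r == p then Some k else if r == q then Some l else w r].
exists (fun w' => (w' == del)%:R - 'X * \sum_k \sum_l polyv v i k l * (w' == sub k l)%:R).
split=> [w'|z d dz].
  rewrite hornerD hornerN hornerM hornerX mul0r subr0 -polyC_natr hornerC.
  have [-> _|_] := eqVneq w' del; last by rewrite eqxx.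
  apply: proper_card; apply/properP; split.
    by apply/subsetP=> r; rewrite !inE ffunE; case: (r == q).
  by exists q; rewrite !inE ?ffunE ?eqxx // -Dwq.
rewrite mul0r subr0.
have Qsum : \sum_w' ((w' == del)%:R - 'X * \sum_k \sum_l polyv v i k l * (w' == sub k l)%:R) * word_val z w'
   = word_val z del - 'X * \sum_k \sum_l polyv v i k l * word_val z (sub k l).
  have pick w0 : \sum_w' (w' == w0)%:R * word_val z w' = word_val z w0.
    by rewrite (bigD1 w0) //= eqxx mul1r big1 ?addr0 // => w' /negPf->; rewrite mul0r.
  rewrite (eq_bigr (fun w' => (w' == del)%:R * word_val z w' - 'X * \sum_k \sum_l
    polyv v i k l * ((w' == sub k l)%:R * word_val z w'))) => [|w' _]; last first.
    rewrite mulrBl -mulrA; congr (_ - _ * _); rewrite mulr_suml; apply: eq_bigr => k _.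
    by rewrite mulr_suml; apply: eq_bigr => l _; rewrite mulrA.
  rewrite sumrB pick -mulr_sumr; congr (_ - _ * _).
  rewrite exchange_big /=; apply: eq_bigr => k _; rewrite exchange_big /=.
  by apply: eq_bigr => l _; rewrite -mulr_sumr pick.
pose m := \prod_(r | (r != p) && (r != q)) letter z (w r).
have val_upd w' : (forall r, r != p -> r != q -> w' r = w r) -> w' p != None ->
    word_val z w' = letter z (w' p) * letter z (w' q) * m.
  move=> Dw' w'p; rewrite /word_val ifT; last by apply/existsP; exists p.
  rewrite (bigD1 p) // (bigD1 q) 1?eq_sym //= mulrA; congr (_ * _ * _).
    by apply: eq_bigr => r /andP[rp rq]; rewrite Dw'.
have qp : (q == p) = false by rewrite eq_sym (negPf ne_pq).
rewrite Qsum !val_upd ?Dwp //; last first.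
- by rewrite ffunE (negPf ne_pq) Dwp.
- by move=> r rp rq; rewrite ffunE (negPf rq).
rewrite -Dwq !ffunE eqxx (negPf ne_pq) Dwp /=.
rewrite (eq_bigr (fun k => (\sum_l polyv v i k l * (z k * z l)) * m)) => [|k _].
  rewrite -mulr_suml -/(qpoly v z i).
  have -> : z i * z i * m - (z i * 1 * m - 'X * (qpoly v z i * m)) = defect v z i * m.
    by rewrite /defect; ring.
  exact: dvdp_mulr.
rewrite mulr_suml; apply: eq_bigr => l _; rewrite val_upd ?ffunE ?eqxx ?qp //= ?mulrA //.
by move=> r /negPf rp /negPf rq; rewrite ffunE rp rq.
Qed.

Lemma word_val_squarefree z w : squarefree w -> word_val z w =
  if letters w == set0 then 0 else monom z (letters w).
Proof.
move=> /forallP nf_w.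
pose D := [set r | w r != None].
have Dw : w @: D = Some @: letters w.
  apply/setP=> o; apply/imsetP/imsetP=> [[r]|[i]]; rewrite inE.
    by case Dwr: (w r) => [i|] // _ ->; exists i; rewrite ?inE ?Dwr //; apply/existsP; exists r; rewrite Dwr.
  by case/existsP=> r /eqP Dwr ->; exists r; rewrite ?inE Dwr.
have -> : (letters w == set0) = ~~ [exists r, w r != None].
  rewrite -(inj_eq (imset_inj (@Some_inj _))) -Dw imset0.
  apply/eqP/existsPn=> [w0 r | w0].
    by apply/negP=> wr; have := imset_f w (_ : r \in D); rewrite w0 !inE wr => /(_ isT).
  by apply/setP=> o; rewrite inE; apply/imsetP=> -[r]; rewrite inE (negPf (w0 r)).
rewrite /word_val if_neg; case: ifP => // _.
transitivity (\prod_(o in w @: D) letter z o); last first.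
  by rewrite Dw big_imset //= => i j _ _ [].
rewrite big_imset /=; last first.
  move=> p q; rewrite !inE => wp wq Dwpq; apply/eqP; apply: contraTT isT => ne_pq.
  by have /forallP/(_ q) := nf_w p; rewrite ne_pq wp Dwpq eqxx.
rewrite [LHS](bigID (mem D)) /= [X in _ * X]big1 ?mulr1 // => r.
by rewrite inE negbK => /eqP->.
Qed.

Definition mul_word i I : word :=
  [ffun r => if r is Some k then (if k \in I then Some k else None) else Some i].

Lemma mul_word_val z i I : word_val z (mul_word i I) = z i * monom z I.
Proof.
rewrite /word_val ifT; last by apply/existsP; exists None; rewrite ffunE.
rewrite (bigD1 None) //= ffunE; congr (_ * _).
rewrite (reindex_onto Some (odflt i)) => [|[]//] /=.
rewrite /monom [RHS]big_mkcond; apply: eq_big => [k|k _]; first by rewrite eqxx.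
by rewrite ffunE; case: ifP.
Qed.

(** Up to [delta], multiplication by a coordinate acts on nonempty squarefree monomials by a matrix
    independent of the solution [z] and of the modulus [d]. Squarefree words with the same letters
    have the same value, so their coefficients are added. *)
Lemma squarefree_reduction :
  exists2 delta : {poly F}, delta.[0] != 0 &
  exists a : 'I_n -> {set 'I_n} -> {set 'I_n} -> {poly F},
  forall z d, (forall i, d %| defect v z i) -> forall i I,
    d %| delta * (z i * monom z I) - \sum_(K | K != set0) a i I K * monom z K.
Proof.
have /fin_all_exists[Q HQ] := word_reduction.
have [delta delta0 [R HR]] := triangular_reduction squarefree (fun w => (HQ w).1).
exists delta => //; exists (fun i I K =>
  \sum_(w | squarefree w && (letters w == K)) R (mul_word i I) w) => z d dz i I.
have := HR d (word_val z) (fun w => (HQ w).2 z d dz) (mul_word i I).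
rewrite mul_word_val; congr (_ %| _ - _).
rewrite (partition_big letters xpredT) //= [RHS]big_mkcond; apply: eq_bigr => K _.
case: ifP => [K0|/negbFE K0].
  rewrite mulr_suml; apply: eq_bigr => w /andP[sq_w /eqP Dw].
  by rewrite word_val_squarefree // Dw (negPf K0).
by rewrite big1 // => w /andP[sq_w /eqP Dw]; rewrite word_val_squarefree // Dw K0 mulr0.
Qed.

End Words.

(** * The algebra of the deformed system *)

Section ActsModulo.
Variables (F : fieldType) (N : nat) (d : {poly F}) (Z : 'M[{poly F}]_N.+1).
Implicit Types (M : 'M[{poly F}]_N.+1) (s : 'I_N.+1 -> {poly F}).

(* [M Z = Z diag(s)] modulo [d]. *)
Definition acts_mod M s := forall r c, d %| (M *m Z) r c - s c * Z r c.

Lemma acts_modM M M' s s' :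
  acts_mod M s -> acts_mod M' s' -> acts_mod (M * M') (fun c => s c * s' c).
Proof.
move=> Ms Ms' r c; rewrite -mulmxE -mulmxA mxE.
have -> : \sum_j M r j * (M' *m Z) j c - s c * s' c * Z r c =
    \sum_j M r j * ((M' *m Z) j c - s' c * Z j c) + s' c * ((M *m Z) r c - s c * Z r c).
  rewrite mulrBr [(M *m Z) r c]mxE mulr_sumr.
  rewrite [X in _ = X + _](eq_bigr (fun j => M r j * (M' *m Z) j c - s' c * (M r j * Z j c))).
    by rewrite sumrB addrA subrK mulrA [s' c * s c]mulrC.
  by move=> j _; rewrite mulrBr mulrCA.
apply: dvdp_add; last exact: dvdp_mull.
by apply: dvdp_sum => j _; apply: dvdp_mull.
Qed.

Lemma acts_modD M M' s s' :
  acts_mod M s -> acts_mod M' s' -> acts_mod (M + M') (fun c => s c + s' c).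
Proof.
move=> Ms Ms' r c; rewrite mulmxDl mxE mulrDl opprD addrACA.
exact: dvdp_add.
Qed.

Lemma acts_modZ a M s : acts_mod M s -> acts_mod (a *: M) (fun c => a * s c).
Proof. by move=> Ms r c; rewrite -scalemxAl mxE -mulrA -mulrBr dvdp_mull. Qed.

Lemma acts_mod_sum (I : Type) (r : seq I) (f : I -> 'M_N.+1) (s : I -> 'I_N.+1 -> {poly F}) :
  (forall i, acts_mod (f i) (s i)) ->
  acts_mod (\sum_(i <- r) f i) (fun c => \sum_(i <- r) s i c).
Proof.
move=> fs; elim: r => [|i r IH].
  by move=> r c; rewrite !big_nil mul0mx mxE mul0r subrr dvdp0.
by have H := acts_modD (fs i) IH; move=> r' c; rewrite !big_cons; apply: H.
Qed.

(** [M *m Z] vanishes modulo [d]; multiplying by [\adj Z] turns it into [\det Z] times [M], and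
    [\det Z] is coprime to [d]. *)
Lemma acts_mod_dvd M s : coprimep d (\det Z) -> acts_mod M s -> (forall c, d %| s c) ->
  forall r c, d %| M r c.
Proof.
move=> co_d Ms ds r c; rewrite -(Gauss_dvdpr _ co_d).
have -> : \det Z * M r c = \sum_j (M *m Z) r j * \adj Z j c.
  have : (M *m Z *m \adj Z) r c = \det Z * M r c.
    by rewrite -mulmxA mul_mx_adj mul_mx_scalar mxE.
  by move=> <-; rewrite mxE.
apply: dvdp_sum => j _; apply: dvdp_mulr.
by rewrite -[(M *m Z) r j](subrK (s j * Z r j)) dvdp_add ?Ms // dvdp_mulr.
Qed.

End ActsModulo.

Lemma dvdp_Xn_eq0 (F : fieldType) (p : {poly F}) : (forall m, 'X^(m.+1) %| p) -> p = 0.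
Proof.
move=> dp; apply/eqP; apply: contraTT isT => p0.
by have := dvdp_leq p0 (dp (size p)); rewrite size_polyXn ltnNge leqnSn.
Qed.

(** Take [c i = x ^+ i] with [x] not a root of the product of the nonzero polynomials
    [\sum_(i in J) 'X^i]. *)
Lemma exists_sum_neq0 (F : fieldType) n : Gamma F ->
  exists c : 'I_n -> F, forall J : {set 'I_n}, J != set0 -> \sum_(i in J) c i != 0.
Proof.
move=> GF; pose p (J : {set 'I_n}) : {poly F} := \sum_(i in J) 'X^i.
have p0 J : J != set0 -> p J != 0.
  case/set0Pn=> i Ji; apply/eqP=> pJ0; have := congr1 (coefp i) pJ0.
  rewrite /= coef0 coef_sum (bigD1 i) //= coefXn eqxx big1 ?addr0 => [/eqP|j /andP[_ ne_ji]].
    by rewrite oner_eq0.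
  by rewrite coefXn -[i == j :> nat]/(i == j) eq_sym (negPf ne_ji).
have [|x] := @Gamma_nonroot _ (\prod_(J : {set 'I_n} | J != set0) p J) GF.
  by rewrite prodf_seq_neq0; apply/allP=> J _; apply/implyP/p0.
rewrite horner_prod prodf_seq_neq0 => /allP px0; exists (fun i => x ^+ i) => J J0.
have := px0 J (mem_index_enum J); rewrite J0 /= horner_sum.
by congr (_ != 0); apply: eq_bigr => i _; rewrite hornerXn.
Qed.

(** [A i] is multiplication by [delta * z_i] on nonempty squarefree monomials. The equation for
    [z_j] enters multiplied by [z_i], which makes both sides [z_i z_j]; the relation is then
    homogeneous, so it tolerates the factor [delta]. *)
Lemma exists_odd_pencil (F : fieldType) n (v : 'I_n -> 'I_n -> 'I_n -> F) :
  Gamma F -> (0 < n)%N -> exists N (A : 'I_n -> 'M[{poly F}]_N.+1) (c : 'I_n -> F),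
  [/\ odd N.+1, forall i j, A i * A j = A j * A i,
    forall i j, A i * (A j ^+ 2 + 'X *: quad (polyv v) A j) =
                A j * (A i ^+ 2 + 'X *: quad (polyv v) A i)
    & \det (\sum_i (c i)%:P *: A i) != 0].
Proof.
move=> GF n_gt0; pose NE := [set~ set0 : {set 'I_n}].
have cardNE : #|NE| = (2 ^ n).-1 by rewrite cardsC1 -cardsT -powersetT card_powerset cardsT card_ord.
have NE_gt0 : (0 < #|NE|)%N by rewrite cardNE -ltnS prednK ?expn_gt0 // (ltn_exp2l 0).
have [N DN] : exists N, #|NE| = N.+1 by exists #|NE|.-1; rewrite prednK.
have odd_N : odd N.+1 by rewrite -DN cardNE -subn1 oddB ?expn_gt0 // oddX /= orbF eqn0Ngt n_gt0.
pose e (r : 'I_N.+1) := enum_val (cast_ord (esym DN) r) : {set 'I_n}.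
have e0 r : e r != set0 by have := enum_valP (cast_ord (esym DN) r); rewrite !inE.
have e_inj : injective e by move=> r r' /enum_val_inj/cast_ord_inj.
have e_onto J : J != set0 -> exists r, J = e r.
  move=> J0; have JNE : J \in NE by rewrite !inE.
  exists (cast_ord DN (enum_rank_in JNE J)).
  by rewrite /e cast_ordK enum_rankK_in.
have e_sum (f : {set 'I_n} -> {poly F}) : \sum_(K | K != set0) f K = \sum_r f (e r).
  rewrite -(big_imset (h := e)) /=; last by move=> r r' _ _; apply: e_inj.
  apply: eq_bigl => K; apply/idP/imsetP=> [/e_onto[r ->]|[r _ ->] //].
  by exists r.
have [delta delta0 [a Ha]] := squarefree_reduction v.
pose A i : 'M[{poly F}]_N.+1 := \matrix_(r, c) a i (e r) (e c).
(* One lifted solution per nonempty vertex gives one column of monomial values. At ['X = 0], an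
   entry of [Z] is 1 if [e r] is included in [e c] and 0 otherwise, so [Z] is triangular with
   respect to cardinality. *)
have Z_ex m : exists (z : 'I_N.+1 -> 'I_n -> {poly F}) (Z : 'M[{poly F}]_N.+1),
    [/\ (\det Z).[0] != 0, forall c i, (z c i).[0] = (i \in e c)%:R,
        forall c i, 'X^(m.+1) %| defect v (z c) i
      & forall i, acts_mod 'X^(m.+1) Z (A i) (fun c => delta * z c i)].
  have /fin_all_exists2[z z0 dz] := fun c : 'I_N.+1 => newton_solution v (e c) m.
  exists z, (\matrix_(r, c) monom (z c) (e r)); split=> // [|i r c].
    rewrite horner_det; apply/det0P=> -[u u0 uZ]; case/eqP: u0.
    suffices u_e k r : (#|e r| < k)%N -> u 0 r = 0.
      by apply/rowP=> r; rewrite mxE (u_e #|e r|.+1).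
    elim: k r => // k IH r; rewrite ltnS => le_rk.
    have /rowP/(_ r) := uZ; rewrite !mxE (bigD1 r) //= big1 => [|s ne_sr].
      rewrite addr0 !mxE /= /horner_eval horner_prod big1 ?mulr1 // => i ri.
      by rewrite z0 ri.
    rewrite !mxE /= /horner_eval horner_prod.
    have [sub_sr | /subsetPn[i si r'i]] := boolP (e s \subset e r); last first.
      by rewrite (bigD1 i) //= z0 (negPf r'i) mul0r mulr0.
    rewrite IH ?mul0r // (leq_trans _ le_rk) // proper_card // properEneq sub_sr andbT.
    by rewrite (inj_eq e_inj).
  rewrite mxE [(\matrix_(_, _) _) r c]mxE -mulrA.
  have := Ha _ _ (dz c) i (e r); rewrite e_sum -dvdpNr opprB.
  by congr (_ %| _ - _); apply: eq_bigr => k _; rewrite !mxE.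
have coX m (Z : 'M[{poly F}]_N.+1) : (\det Z).[0] != 0 -> coprimep 'X^(m.+1) (\det Z).
  move=> Z0; apply: coprimep_expl.
  by rewrite coprimep_sym -['X]subr0 -polyC0 coprimep_XsubC.
(* Matrices acting on the lifted solutions by congruent functions are equal, since every power of
   ['X] divides their difference. *)
have eq_mx (M M' : 'M[{poly F}]_N.+1) (s s' : ('I_n -> {poly F}) -> {poly F}) :
    (forall m z Z, (forall i, acts_mod 'X^(m.+1) Z (A i) (fun c => delta * z c i)) ->
      acts_mod 'X^(m.+1) Z M (fun c => s (z c)) /\ acts_mod 'X^(m.+1) Z M' (fun c => s' (z c))) ->
    (forall d z, (forall i, d %| defect v z i) -> d %| s z - s' z) -> M = M'.
  move=> sM ss'; apply/eqP; rewrite -subr_eq0; apply/eqP/matrixP=> r c; rewrite [RHS]mxE.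
  apply: dvdp_Xn_eq0 => m; have [z [Z [Z0 _ dz HA]]] := Z_ex m; have [sz sz'] := sM m z Z HA.
  rewrite -scaleN1r in sz' *.
  have := acts_modD sz (acts_modZ (-1) sz'); rewrite scaleN1r => Hd.
  apply: (acts_mod_dvd (coX m Z Z0) Hd) => c'; rewrite mulN1r.
  exact: ss'.
have [c Hc] := exists_sum_neq0 n GF.
exists N, A, c; split=> // [i j|i j|].
- apply: (eq_mx _ _ (fun z => delta * z i * (delta * z j)) (fun z => delta * z j * (delta * z i))).
    by move=> m z Z HA; split; apply: acts_modM.
  by move=> d z _; rewrite mulrC subrr dvdp0.
- pose s i j z := delta * z i * ((delta * z j) * (delta * z j) +
    'X * \sum_k \sum_l polyv v j k l * ((delta * z k) * (delta * z l))).
  apply: (eq_mx _ _ (s i j) (s j i)) => [m z Z HA | d z dz].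
    have act i' j' : acts_mod 'X^(m.+1) Z (A i' * (A j' ^+ 2 + 'X *: quad (polyv v) A j'))
        (fun c => s i' j' (z c)).
      apply: acts_modM => //; apply: acts_modD; first exact: acts_modM.
      apply: acts_modZ; apply: acts_mod_sum => k; apply: acts_mod_sum => l.
      by apply: acts_modZ; apply: acts_modM.
    by [].
  have sE i' j' : s i' j' z = delta ^+ 3 * (z i' * (defect v z j' + z j')).
    have q_delta : \sum_k \sum_l polyv v j' k l * (delta * z k * (delta * z l)) =
        delta ^+ 2 * qpoly v z j'.
      by rewrite mulr_sumr; apply: eq_bigr => k _; rewrite mulr_sumr; apply: eq_bigr => l _; ring.
    by rewrite /s q_delta /defect; ring.
  have -> : s i j z - s j i z = delta ^+ 3 * (z i * defect v z j - z j * defect v z i).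
    by rewrite !sE; ring.
  by apply: dvdp_mull; apply: dvdp_sub; apply: dvdp_mull.
(* At ['X = 0], [Z] diagonalizes the combination, with eigenvalues [delta.[0]] times sums of [c]
   over nonempty sets. *)
apply/eqP=> det0; have [z [Z [Z0 z0 _ HA]]] := Z_ex 0%N.
have actS : acts_mod 'X Z (\sum_i (c i)%:P *: A i) (fun k => \sum_i (c i)%:P * (delta * z k i)).
  by apply: acts_mod_sum => i; apply: acts_modZ; apply: HA.
have : (\det ((\sum_i (c i)%:P *: A i) *m Z)).[0] = (\det (Z *m diag_mx
   (\row_k \sum_i (c i)%:P * (delta * z k i)))).[0].
  rewrite !horner_det; congr (\det _); apply/matrixP=> r k; rewrite mul_mx_diag !mxE /= /horner_eval.
  have := actS r k; rewrite mxE dvdpX_root hornerD hornerN subr_eq0 => /eqP->.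
  by rewrite mulrC.
rewrite !det_mulmx det0 mul0r horner0 hornerM det_diag => /esym/eqP.
rewrite mulf_eq0 (negPf Z0) horner_prod; apply/negP; rewrite prodf_seq_neq0; apply/allP => k _ /=.
rewrite mxE horner_sum (eq_bigr (fun i => delta.[0] * (if i \in e k then c i else 0))).
  by rewrite -mulr_sumr -big_mkcond mulf_neq0 ?Hc.
by move=> i _; rewrite !hornerM hornerC z0; case: ifP; rewrite ?mulr1 ?mulr0 // mulrC.
Qed.

(** * Eigenvectors *)

(** On a common eigenvector of the [Y i] the relation reads [x_i q_j = x_j q_i], so [q] is
    proportional to [x], and [\sum_i a i * x i = 1] excludes [x = 0]. *)
Lemma Gamma_quadratic_eigenvector (F : fieldType) n (v : 'I_n -> 'I_n -> 'I_n -> F) :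
  Gamma F -> (0 < n)%N -> exists (x : 'I_n -> F) (i0 : 'I_n) (l : F), x i0 != 0 /\
    forall i, \sum_j \sum_k v i j k * (x j * x k) = l * x i.
Proof.
move=> GF n_gt0; have [N [A [c [odd_N commA relA detA]]]] := exists_odd_pencil v GF n_gt0.
have [a [Y [commY sumY relY]]] := odd_pencil_limit GF commA relA detA.
have [u u0 /fin_all_exists[x ux]] := Gamma_common_eigenvector GF odd_N commY.
have uM (f g : 'M[F]_N.+1) s t : u *m f = s *: u -> u *m g = t *: u ->
    u *m (f * g) = (s * t) *: u.
  by move=> uf ug; rewrite -mulmxE mulmxA uf -scalemxAl ug scalerA.
have uY i : u *m quad v Y i = (\sum_j \sum_k v i j k * (x j * x k)) *: u.
  rewrite /quad mulmx_sumr scaler_suml; apply: eq_bigr => j _.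
  rewrite mulmx_sumr scaler_suml; apply: eq_bigr => k _.
  by rewrite -scalemxAr (uM _ _ _ _ (ux j) (ux k)) scalerA.
have u_inj s t : s *: u = t *: u -> s = t.
  by move=> /eqP; rewrite -subr_eq0 -scalerBl scaler_eq0 (negPf u0) orbF subr_eq0 => /eqP.
have sumx : \sum_i a i * x i = 1.
  apply: u_inj; transitivity (u *m (\sum_i a i *: Y i)); last by rewrite sumY scale1r; apply: mulmx1.
  rewrite mulmx_sumr scaler_suml; apply: eq_bigr => i _.
  by rewrite -scalemxAr ux scalerA.
have [i0 xi0] : exists i0, x i0 != 0.
  apply/existsP; apply: contraT => /existsPn x0; move/eqP: sumx.
  by rewrite big1 ?(eq_sym 0) ?oner_eq0 // => i _; move/negPn/eqP: (x0 i) => ->; rewrite mulr0.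
pose q i := \sum_j \sum_k v i j k * (x j * x k).
exists x, i0, (q i0 / x i0); split=> // i; apply: (mulfI xi0).
have /u_inj : (x i0 * q i) *: u = (x i * q i0) *: u.
  by rewrite -(uM _ _ _ _ (ux i0) (uY i)) relY (uM _ _ _ _ (ux i) (uY i0)).
by move=> ->; field.
Qed.

(** Structure constants in a basis yield [y] nonzero with [mul y y = l *: y]. It is an absolute
    nilpotent if [l = 0]; otherwise [l^-1 *: y] is an idempotent. *)
Lemma Gamma_Lambda (F : fieldType) : Gamma F -> Lambda F.
Proof.
move=> GF A mul dimA; set n := \dim {:A} in dimA; pose b := vbasis {:A}.
have b_basis : basis_of {:A} b := vbasisP _.
have [x [i0 [l [xi0 Dx]]]] := Gamma_quadratic_eigenvector
  (fun i j k : 'I_n => coord b i (mul b`_j b`_k)) GF dimA.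
pose y := \sum_i x i *: b`_i.
have y0 : y <> 0.
  move=> y0; have /freeP/(_ x y0 i0) xi00 := basis_free b_basis.
  by rewrite xi00 eqxx in xi0.
have Dyy : mul y y = l *: y.
  have -> : mul y y = \sum_j \sum_k (x j * x k) *: mul b`_j b`_k.
    rewrite {1}/y linear_sumlz; apply: eq_bigr => j _; rewrite linear_sumr; apply: eq_bigr => k _.
    by rewrite linearZl_LR linearZr_LR scalerA.
  rewrite (coord_basis b_basis (memvf (\sum_j _))) scaler_sumr; apply: eq_bigr => i _.
  rewrite scalerA -Dx; congr (_ *: _); rewrite linear_sum; apply: eq_bigr => j _.
  by rewrite linear_sum; apply: eq_bigr => k _; rewrite linearZ; apply: mulrC.
have [l0 | l0] := eqVneq l 0; [right | left].
  by exists y; split=> //; rewrite Dyy l0 scale0r.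
exists (l^-1 *: y); split.
  by move/eqP; rewrite scaler_eq0 invr_eq0 (negPf l0) => /eqP.
by rewrite linearZl_LR linearZr_LR Dyy !scalerA -mulrA mulVf // mulr1.
Qed.

Theorem corollary2p3 (F : fieldType) (charF : 2%N \notin [pchar F]) :
  Lambda F <-> Gamma F.
Proof. by split; [apply: Lambda_Gamma | apply: Gamma_Lambda]. Qed.
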